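(* Let $G$ be a finite, simple, connected graph which is $3$-$\gamma_{c}$-critical. Then $\alpha(G) \leq \kappa(G) + 2$.
   Context: All graphs are finite, simple and connected. A set $D \subseteq V(G)$ is a connected dominating set of $G$ if every vertex of $G$ is in $D$ or adjacent to a vertex of $D$, and the induced subgraph $G[D]$ is connected; the connected domination number $\gamma_{c}(G)$ is the minimum size of such a set. For non-adjacent vertices $u,v$, $G+uv$ denotes $G$ with the edge $uv$ added. $G$ is $3$-$\gamma_{c}$-critical if $\gamma_{c}(G)=3$ and $\gamma_{c}(G+uv)<3$ for every pair of non-adjacent vertices $u,v$ of $G$. $\alpha(G)$ is the independence number (maximum size of a set of pairwise non-adjacent vertices), $\delta(G)$ the minimum degree, and $\kappa(G)$ the connectivity, i.e. the minimum size of a vertex cut set (a set $S$ of vertices with $G-S$ disconnected). *)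

(* Defs.v *)
From mathcomp Require Import all_boot.

Set Implicit Arguments.
Unset Strict Implicit.
Unset Printing Implicit Defensive.

(* A graph is its adjacency relation on a finite vertex type; simplicity is
   symmetry and irreflexivity of that relation. *)
Section Graph.
Variables (T : finType) (e : rel T).

Definition simple_graph := symmetric e /\ irreflexive e.

Definition induced (A : {set T}) : rel T := [rel x y in A | e x y].

(* Connectedness of the induced subgraph on A; vacuously true if A is empty,
   so that deleting every vertex does not count as disconnecting the graph. *)
Definition connected_on (A : {set T}) :=
  [forall x in A, forall y in A, connect (induced A) x y].

Definition connected_graph := connected_on [set: T].

Definition dominating (D : {set T}) :=
  [forall x, (x \in D) || [exists y in D, e x y]].

Definition connected_dominating (D : {set T}) :=
  dominating D && connected_on D.

(* The default [set: T] is itself a connected dominating set when the graph is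
   connected. *)
Definition gammac :=
  #|[arg min_(D < [set: T] | connected_dominating D) #|D|]|.

Definition add_edge (u v : T) : rel T :=
  [rel x y | [|| e x y, (x == u) && (y == v) | (x == v) && (y == u)]].

Definition independent (A : {set T}) := [forall x in A, forall y in A, ~~ e x y].

Definition alpha := \max_(A : {set T} | independent A) #|A|.

Definition vertex_cut (S : {set T}) := ~~ connected_on (~: S).

(* Complete graphs have no vertex cut; they get the usual value #|T| - 1. *)
Definition kappa :=
  if [pick S | vertex_cut S] is Some S0
  then #|[arg min_(S < S0 | vertex_cut S) #|S|]| else #|T|.-1.

End Graph.

Definition gammac_critical (k : nat) (T : finType) (e : rel T) :=
  gammac e = k /\
  forall u v : T, u != v -> ~~ e u v -> gammac (add_edge e u v) < k.

(* Main.v *)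
(* Let I be independent with at least three elements.  For distinct u, v in I,
   criticality yields, up to exchanging u and v, a neighbour x of u such that
   {u, x} dominates everything except v; write u -> v.  This makes I a
   semicomplete digraph, which has a Hamiltonian path a_1 -> ... -> a_p with
   witnesses x_1, ..., x_(p-1).  As x_i misses exactly a_(i+1) in I, the p-1
   pairs {a_i, x_i} are pairwise disjoint.  If such a pair avoids a vertex cut
   S, its component of G - S contains everything but a_(i+1); two pairs cannot
   both do so.  Hence S meets all pairs but one, and p - 2 <= #|S|. *)
Require Import Defs.
From mathcomp Require Import all_boot.

Set Implicit Arguments.
Unset Strict Implicit.
Unset Printing Implicit Defensive.

(** * Connected dominating sets with at most two vertices *)

Section ConnectedDominatingPairs.
Variables (T : finType) (e : rel T).
Hypotheses (e_sym : symmetric e) (e_irr : irreflexive e).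

(* d = w is allowed, so that this also covers one-element dominating sets. *)
Definition connected_dominating_pair (d w : T) :=
  ((d == w) || e d w) && [forall z, [|| z == d, z == w, e z d | e z w]].

Lemma connected_dominating_pairC d w :
  connected_dominating_pair d w = connected_dominating_pair w d.
Proof.
rewrite /connected_dominating_pair eq_sym e_sym; congr andb.
by apply: eq_forallb => z; rewrite orbCA; do 2 congr orb; rewrite orbC.
Qed.

Lemma connected_dominating_setT :
  connected_graph e -> connected_dominating e [set: T].
Proof.
by move=> cG; apply/andP; split => //; apply/forallP => x; rewrite inE.
Qed.

Lemma connected_dominating_pairE d w :
  connected_dominating_pair d w = connected_dominating e [set d; w].
Proof.
apply/andP/andP => -[].
  move=> dw /forallP dom; split.
    apply/forallP => z; have := dom z; rewrite !inE.
    case/or4P => h; first by rewrite h.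
    - by rewrite h orbT.
    - by apply/orP; right; apply/existsP; exists d; rewrite !inE eqxx.
    - by apply/orP; right; apply/existsP; exists w; rewrite !inE eqxx orbT.
  apply/forall_inP => x xD; apply/forall_inP => y yD.
  have [->|xy] := eqVneq x y; first exact: connect0.
  apply/connect1/andP; split; first exact/andP.
  move: xD yD xy dw; rewrite !inE.
  by do 2 case/orP=> /eqP->; rewrite ?eqxx // => /negPf;
    [|rewrite eq_sym e_sym] => ->.
move=> /forallP dom /forall_inP con; split.
  have [//|dw /=] := eqVneq d w.
  have /forall_inP/(_ w) := con d (set21 _ _).
  (* The first step of a path from [d] to [w] inside [[set d; w]] cannot be a loop, so it is the
     edge from [d] to [w]. *)
  move=> /(_ (set22 _ _)) /connectP[[|z p] /=].
    by move=> _ E; rewrite E eqxx in dw.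
  case/andP=> /andP[/andP[_]]; rewrite !inE.
  by case/orP=> /eqP->; rewrite ?e_irr.
apply/forallP => z; have := dom z; rewrite !inE -!orbA.
case/or3P => [->//|->|]; first by rewrite orbT.
case/existsP=> y; rewrite !inE => /andP[/orP[]/eqP-> ->]; by rewrite !orbT.
Qed.

Lemma gammac_le D :
  connected_graph e -> connected_dominating e D -> gammac e <= #|D|.
Proof.
move=> cG cD; rewrite /gammac; case: arg_minnP => [|M _]; last exact.
exact: connected_dominating_setT.
Qed.

(** A minimum connected dominating set is nonempty because [T] is; below size three it is therefore
    some [[set d; w]]. This turns criticality into a statement about two named vertices. *)
Lemma gammac_lt3P :
  (0 < #|T|) -> connected_graph e ->
  (gammac e < 3) <-> (exists d w, connected_dominating_pair d w).
Proof.
move=> T_gt0 cG; split; last first.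
  move=> [d] [w]; rewrite connected_dominating_pairE => /(gammac_le cG) h.
  by rewrite ltnS (leq_trans h) // cards2; case: eqP.
rewrite /gammac; case: arg_minnP => [|D cD _ D3].
  exact: connected_dominating_setT.
have [D0|[d dD]] := set_0Vmem D.
  case/card_gt0P: T_gt0 => t _.
  case/andP: cD => /forallP/(_ t); rewrite D0 inE /=.
  by case/existsP=> y; rewrite inE.
exists d; have [D1|[w wD]] := set_0Vmem (D :\ d).
  exists d; rewrite connected_dominating_pairE setUid.
  by rewrite -[[set d]]setU0 -D1 setD1K.
exists w; rewrite connected_dominating_pairE; suff -> : [set d; w] = D by [].
apply/eqP; rewrite eqEcard subUset !sub1set dD.
move: (wD); rewrite !inE => /andP[wd ->] /=.
by rewrite cards2 eq_sym wd.
Qed.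

End ConnectedDominatingPairs.

(** * Graphs with one added edge *)

Section AddEdge.
Variables (T : finType) (e : rel T).

Lemma add_edgeE u v x y :
  add_edge e u v x y =
    [|| e x y, (x == u) && (y == v) | (x == v) && (y == u)].
Proof. by []. Qed.

Lemma add_edge_sym u v : symmetric e -> symmetric (add_edge e u v).
Proof.
move=> e_sym x y; rewrite !add_edgeE e_sym; congr orb.
by rewrite orbC andbC [X in _ || X]andbC.
Qed.

Lemma add_edge_irr u v :
  u != v -> irreflexive e -> irreflexive (add_edge e u v).
Proof.
move=> uv e_irr x; rewrite add_edgeE e_irr /=.
by have [->|] := eqVneq x u; rewrite /= ?andbF ?(negPf uv).
Qed.

Lemma add_edgeC u v : add_edge e u v =2 add_edge e v u.
Proof. by move=> x y; rewrite !add_edgeE [X in _ || X]orbC. Qed.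

Lemma add_edge_connected u v :
  connected_graph e -> connected_graph (add_edge e u v).
Proof.
move=> /forall_inP cG; apply/forall_inP => x xT; apply/forall_inP => y yT.
have /forall_inP/(_ y yT) := cG x xT.
apply: connect_sub => {xT yT} {}x {}y /= /andP[xyT xy]; apply: connect1.
by apply/andP; rewrite add_edgeE xy.
Qed.

Lemma add_edge_off u v x y :
  y != u -> y != v -> add_edge e u v x y = e x y.
Proof. by move=> /negPf yu /negPf yv; rewrite add_edgeE yu yv !andbF !orbF. Qed.

End AddEdge.

(** * Arrows in a critical graph, and vertex cuts *)

Section Critical.
Variables (T : finType) (e : rel T).
Hypotheses (e_sym : symmetric e) (e_irr : irreflexive e).
Hypotheses (G_conn : connected_graph e) (G_crit : gammac_critical 3 e).

(** Non-adjacency of [u] and [v] is not a clause: it comes from the independent set that contains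
    both. *)
Definition dominates_all_but (u v x : T) :=
  [&& e u x, ~~ e x v & [forall z, [|| z == v, z == u, z == x, e z u | e z x]]].

Definition arrow (u v : T) := [exists x, dominates_all_but u v x].

Lemma no_connected_dominating_pair d w : ~~ connected_dominating_pair e d w.
Proof.
apply/negP => cdw; have T0 : 0 < #|T| by apply/card_gt0P; exists d.
have [_ /(_ (ex_intro _ d (ex_intro _ w cdw)))] := gammac_lt3P e_sym e_irr T0 G_conn.
by rewrite (proj1 G_crit).
Qed.

(** Neither [u] nor [v] dominates [t], so [w] is a third vertex and the new edge serves only to let
    [u] dominate [v]. Were [w] adjacent to [v], the pair would already work in the original
    graph. *)
Lemma arrow_of_pair u v t w :
  u != v -> t != u -> t != v -> ~~ e t u -> ~~ e t v ->
  connected_dominating_pair (add_edge e u v) u w -> arrow u v.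
Proof.
move=> uv tu tv etu etv /andP[uw /forallP dom].
have wu : w != u.
  apply/negP => /eqP wu; have := dom t; rewrite wu !add_edgeE.
  by rewrite (negPf tu) (negPf tv) (negPf etu).
have wv : w != v.
  apply/negP => /eqP wv; have := dom t; rewrite wv !add_edgeE.
  by rewrite (negPf tu) (negPf tv) (negPf etu) (negPf etv).
have euw : e u w by move: uw; rewrite eq_sym (negPf wu) add_edge_off.
have dom' z : [|| z == v, z == u, z == w, e z u | e z w].
  have := dom z; rewrite (@add_edge_off _ _ _ _ z w) // add_edgeE.
  have [//|zv] := eqVneq z v; rewrite eqxx (negPf uv) andbF /= !orbF.
  by [].
apply/existsP; exists w; apply/and3P; split => //; last exact/forallP.
apply/negP => ewv; have /negP[] := no_connected_dominating_pair u w.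
rewrite /connected_dominating_pair euw orbT; apply/forallP => z.
by case/orP: (dom' z) => // /eqP->; rewrite (e_sym v w) ewv !orbT.
Qed.

(** A connected dominating pair of the enlarged graph contains [u] or [v]: otherwise the new edge
    does not affect it, and it contradicts [gammac e = 3]. *)
Lemma arrow_total u v t :
  u != v -> t != u -> t != v -> ~~ e u v -> ~~ e t u -> ~~ e t v ->
  arrow u v || arrow v u.
Proof.
move=> uv tu tv euv etu etv.
have T0 : 0 < #|T| by apply/card_gt0P; exists u.
have [/(_ (proj2 G_crit u v uv euv))] :=
  gammac_lt3P (add_edge_sym u v e_sym) (add_edge_irr uv e_irr) T0
    (add_edge_connected u v G_conn).
move=> [d] [w] cdw _.
have at_end d' w' : connected_dominating_pair (add_edge e u v) d' w' ->
    (d' == u) || (d' == v) -> arrow u v || arrow v u.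
  move=> c /orP[] /eqP E; rewrite {}E in c.
    by rewrite (arrow_of_pair uv tu tv etu etv c).
  rewrite orbC (@arrow_of_pair v u t w') // 1?eq_sym //.
  move: c; rewrite /connected_dominating_pair add_edgeC => /andP[-> /forallP c].
  by apply/forallP => z; rewrite ![add_edge e v u _ _]add_edgeC.
have [|] := boolP ((d == u) || (d == v)); first exact: at_end cdw.
rewrite negb_or => /andP[du dv].
have [|] := boolP ((w == u) || (w == v)).
  by apply: (at_end _ d); rewrite connected_dominating_pairC //; exact: add_edge_sym.
rewrite negb_or => /andP[wu wv].
have /negP[] := no_connected_dominating_pair d w.
move: cdw; rewrite /connected_dominating_pair add_edge_off // => /andP[-> /forallP c].
by apply/forallP => z; have := c z; rewrite !add_edge_off.
Qed.

Definition witness (u v : T) := odflt u [pick x | dominates_all_but u v x].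

Lemma witnessP u v : arrow u v -> dominates_all_but u v (witness u v).
Proof.
rewrite /witness; case: pickP => [//|no] /existsP[x].
by rewrite no.
Qed.

(* Merge sort outputs a chain for any total relation, transitive or not. *)
Lemma hamiltonian_arrow_path (I : {set T}) :
  independent e I -> 2 < #|I| ->
  exists2 l, perm_eq l (enum I) & sorted arrow l.
Proof.
move=> /forall_inP ind I3.
(* Totality covers the diagonal, hence the equality; it drops out at the end because the sorted list
   has no repetition. *)
pose r := [rel u v | (u == v) || arrow u v].
have indep u v : u \in I -> v \in I -> ~~ e u v.
  by move=> uI vI; have /forall_inP/(_ v vI) := ind u uI.
have r_total : {in [in I] &, total r}.
  move=> u v uI vI; rewrite /= [v == u]eq_sym.
  have [//|uv] := eqVneq u v.
  (* The third element of [I] is the vertex [t] required by [arrow_total]. *)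
  have /set0Pn[t] : I :\: [set u; v] != set0.
    rewrite -card_gt0 cardsD subn_gt0 (leq_ltn_trans _ I3) //.
    by rewrite (leq_trans (subset_leq_card (subsetIr _ _))) // cards2 uv.
  rewrite !inE negb_or => /andP[/andP[tu tv] tI] /=.
  by apply: (arrow_total uv tu tv); apply: indep.
exists (sort r (enum I)); first by rewrite perm_sort.
have : sorted r (sort r (enum I)).
  by apply: (sort_sorted_in r_total); apply/allP => x; rewrite mem_enum.
have : uniq (sort r (enum I)) by rewrite sort_uniq enum_uniq.
case: (sort r (enum I)) => // a l; elim: l a => //= b l IH a.
case/andP; rewrite inE negb_or => /andP[/negPf ab _] ul.
by rewrite ab /= => /andP[-> /IH->].
Qed.

(** The first pair forces [v] outside [S] and out of the component of [u]. If [v] and [v'] differed,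
    the second pair would join [v] to [u'], and the first would join [u'] to [u]. *)
Lemma pairs_avoiding_cut_agree (S : {set T}) u v x u' v' x' :
  vertex_cut e S ->
  dominates_all_but u v x -> u \notin S -> x \notin S ->
  dominates_all_but u' v' x' -> u' \notin S -> x' \notin S ->
  v = v'.
Proof.
move=> cut; pose c := connect (induced e (~: S)).
have c_sym : connect_sym (induced e (~: S)).
  by apply: sym_connect_sym => y z; rewrite /induced /= e_sym [X in X && _]andbC.
have c_edge y z : y \notin S -> z \notin S -> e y z -> c y z.
  by move=> yS zS yz; apply: connect1; rewrite /induced /= !inE yS zS.
have c_trans : transitive c by exact: connect_trans.
have almost a b y : dominates_all_but a b y -> a \notin S -> y \notin S ->
    forall z, z \notin S -> z != b -> c a z.
  move=> /and3P[ay _ /forallP dom] aS yS z zS zb.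
  have cay := c_edge _ _ aS yS ay.
  case/or4P: (dom z) => [|/eqP->|/eqP->//|]; first by rewrite (negPf zb).
    exact: connect0.
  by case/orP => [za|zy]; [|apply: c_trans cay _]; apply: c_edge; rewrite // e_sym.
have missed a b y : dominates_all_but a b y -> a \notin S -> y \notin S ->
    (b \notin S) && ~~ c a b.
  move=> D aS yS; apply: contraR cut => nb.
  have all_c z : z \notin S -> c a z.
    move=> zS; have [zb|] := eqVneq z b; last exact: almost D _ _ _ _.
    by move: nb; rewrite -zb zS negbK.
  apply/forall_inP => p; rewrite inE => pS; apply/forall_inP => q; rewrite inE => qS.
  by apply: c_trans (all_c q qS); rewrite /c c_sym; apply: all_c.
move=> D uS xS D' u'S x'S; apply/eqP/negPn/negP => vv'.
have /andP[vS /negP[]] := missed _ _ _ D uS xS.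
have cu'v : c u' v by apply: almost D' _ _ _ _ _.
apply: (c_trans u') cu'v.
(* If [u'] is [v], the first pair does not reach it directly, but it reaches the neighbour [x'],
   which differs from [v]. *)
have [u'v|] := eqVneq u' v; last exact: almost D _ _ _ _.
have /and3P[eu'x' _ _] := D'.
have x'v : x' != v.
  by apply/negP => /eqP x'v; move: eu'x'; rewrite x'v u'v e_irr.
apply: (c_trans x') (almost _ _ _ D uS xS _ x'S x'v) _.
by apply: c_edge; rewrite // e_sym.
Qed.

Lemma independent_le_cut (I S : {set T}) :
  independent e I -> vertex_cut e S -> #|I| <= #|S| + 2.
Proof.
move=> ind cut; have [I2|I3] := leqP #|I| 2; first by rewrite (leq_trans I2) // leq_addl.
have [l l_perm l_sorted] := hamiltonian_arrow_path ind I3.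
have indep u v : u \in I -> v \in I -> ~~ e u v.
  by move: ind => /forall_inP h uI vI; have /forall_inP/(_ v vI) := h u uI.
have l_uniq : uniq l by rewrite (perm_uniq l_perm) enum_uniq.
have [t0 _] : exists t, t \in I by apply/card_gt0P; exact: leq_trans I3.
have sz_l : size l = #|I| by rewrite (perm_size l_perm) -cardE.
(* [n] counts the arcs of the path, whose vertices are [a 0] to [a n]. *)
set n := #|I|.-1.
have nE : #|I| = n.+1 by rewrite prednK // (leq_trans _ I3).
pose a (k : nat) := nth t0 l k; pose x (k : nat) := witness (a k) (a k.+1).
have aI k : k <= n -> a k \in I.
  by move=> kn; rewrite -mem_enum -(perm_mem l_perm) mem_nth // sz_l nE.
have a_inj k k' : k <= n -> k' <= n -> a k = a k' -> k = k'.
  by move=> kn k'n /eqP; rewrite nth_uniq ?sz_l ?nE // => /eqP.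
have xP (i : 'I_n) : dominates_all_but (a i) (a i.+1) (x i).
  by apply: witnessP; apply: (sortedP t0 l_sorted); rewrite sz_l nE ltnS.
have x_notin (i : 'I_n) : x i \notin I.
  apply/negP => xI; have /and3P[] := xP i.
  by rewrite (negPf (indep _ _ _ xI)) // aI // ltnW.
have x_adj (i : 'I_n) b : b \in I -> b != a i.+1 -> e b (x i).
  move=> bI ba; have /and3P[eax _ /forallP/(_ b)] := xP i.
  rewrite (negPf ba) /= => /or4P[/eqP->//|/eqP bx|bai|//].
    by have := x_notin i; rewrite -bx bI.
  by move: bai; rewrite (negPf (indep _ _ bI _)) // aI // ltnW.
(* The only element of [I] that [x i] misses is [a i.+1], so [x i] determines [i]. *)
have x_inj (i j : 'I_n) : x i = x j -> i = j.
  move=> xij; apply/val_inj/succn_inj/a_inj => //=.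
  apply/eqP/negPn/negP => neq.
  have := x_adj j _ (aI i.+1 (ltn_ord i)) neq.
  by have /and3P[_ + _] := xP i; rewrite e_sym -xij => /negPf->.
pose B := [set i : 'I_n | (a i \notin S) && (x i \notin S)].
have B1 : #|B| <= 1.
  apply/card_le1_eqP => j i; rewrite !inE => /andP[ajS xjS] /andP[aiS xiS].
  apply/val_inj/succn_inj/a_inj => //=.
  exact: pairs_avoiding_cut_agree cut (xP i) aiS xiS (xP j) ajS xjS.
(* [h] selects one vertex from each pair, lying in [S] whenever the pair meets [S]; disjointness of
   the pairs makes it injective. *)
pose h (i : 'I_n) := if a i \in S then a i else x i.
have h_inj : injective h.
  move=> i j; rewrite /h.
  have in_out (k k' : 'I_n) : a k <> x k'.
    by move=> E; have := x_notin k'; rewrite -E aI // ltnW.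
  case: ifP => _; case: ifP => _ E; [|by case: (in_out _ _ E)|by case: (in_out j i)|].
    by apply/val_inj/a_inj => //=; apply: ltnW.
  exact: x_inj.
have hS : [set h i | i in ~: B] \subset S.
  apply/subsetP => y /imsetP[i]; rewrite !inE /h => iB ->.
  by case: (boolP (a i \in S)) iB => // _ /=; rewrite negbK.
have := subset_leq_card hS; rewrite card_imset // => BS.
have := cardsC B; rewrite card_ord nE => <-.
by rewrite addnC -addnS leq_add.
Qed.

End Critical.

Theorem theorem3p2 (T : finType) (e : rel T) :
  simple_graph e -> connected_graph e -> gammac_critical 3 e ->
  alpha e <= kappa e + 2.
Proof.
move=> [e_sym e_irr] G_conn G_crit; apply/bigmax_leqP => I ind.
rewrite /kappa; case: pickP => [S0 cut0|_].
  by case: arg_minnP => // S cut _; apply: independent_le_cut.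
(* Without a vertex cut, [kappa e] is [#|T|.-1], and [#|I|] is at most [#|T|]. *)
by rewrite addn2 (leq_trans (max_card _)) // ltnW // ltnS leqSpred.
Qed.
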